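(* For all real numbers $a_s^{\min}, a_n^{\min}, a_n^{\max}, T, v, a_n$ such that $$0 < a_n^{\min},\quad 0 < a_n^{\max},\quad 0 < T,\quad a_n^{\min} < a_s^{\min},\quad 0 \le v,\quad -a_n^{\min} \le a_n \le a_n^{\max},$$ one has $$\mathrm{msd}_1 \ge \mathrm{msd}_3 \quad\text{and}\quad \mathrm{msd}_5 \ge \mathrm{msd}_3,$$ where $$\mathrm{msd}_1 = vT + \frac{a_n^{\max} T^2}{2} + \frac{(v + a_n^{\max} T)^2}{2 a_s^{\min}},$$ $$\mathrm{msd}_3 = \begin{cases} vT + \dfrac{a_n T^2}{2} + \dfrac{(v + a_n T)^2}{2 a_s^{\min}} & \text{if } v + a_n T \ge 0,\\[2mm] -\dfrac{v^2}{2 a_n} & \text{otherwise,}\end{cases}$$ $$\mathrm{msd}_5 = \begin{cases} vT + \dfrac{a_n T^2}{2} + \dfrac{(v + a_n T)^2}{2 a_n^{\min}} & \text{if } v + a_n T \ge 0,\\[2mm] -\dfrac{v^2}{2 a_n} & \text{otherwise.}\end{cases}$$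
   Context: Here $\mathrm{msd}_1$, $\mathrm{msd}_3$, $\mathrm{msd}_5$ are the minimal safety distances to a critical position below which the safety controllers of three different vehicle-control designs intervene by braking; $v$ is the vehicle's velocity, $a_n$ the requested nominal acceleration, $T$ the sampling time, and $a_n^{\min}, a_n^{\max}, a_s^{\min}$ acceleration/braking bounds. *)

(* Defs.v *)
From Stdlib Require Import Reals.
Open Scope R_scope.

(* The bounds [as_min] and [an_min] are magnitudes: the braking decelerations
   they describe are [- as_min] and [- an_min].  [an] is signed. *)

Definition msd1 (as_min an_max T v : R) : R :=
  v * T + an_max * T ^ 2 / 2 + (v + an_max * T) ^ 2 / (2 * as_min).

(* If [v + an * T < 0] the vehicle stops within the sampling period, after
   travelling [- v ^ 2 / (2 * an)]; when moreover [0 <= v] and [0 < T], this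
   forces [an < 0], so the denominator is nonzero. *)
Definition msd3 (as_min T v an : R) : R :=
  if Rle_dec 0 (v + an * T)
  then v * T + an * T ^ 2 / 2 + (v + an * T) ^ 2 / (2 * as_min)
  else - (v ^ 2 / (2 * an)).

Definition msd5 (an_min T v an : R) : R :=
  if Rle_dec 0 (v + an * T)
  then v * T + an * T ^ 2 / 2 + (v + an * T) ^ 2 / (2 * an_min)
  else - (v ^ 2 / (2 * an)).

(* Main.v *)
Require Import Defs.
From Stdlib Require Import Reals Lra.
Open Scope R_scope.

(** [msd3] and [msd5] branch on the same guard, so one case split serves both bounds. If
    [0 <= v + an * T], [msd1] and [msd5] come from [msd3] by raising the acceleration to [an_max] or
    weakening the brake to [an_min]; both lengthen the distance ([sqr_div_le_compat]). Otherwise the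
    stopping distance is at most [v * T] ([stopping_distance_le]), the first of the nonnegative
    terms of [msd1]. *)

Lemma sqr_div_le_compat (x y c d : R) :
  0 <= x <= y -> 0 < c <= d -> x ^ 2 / (2 * d) <= y ^ 2 / (2 * c).
Proof.
intros Hxy Hcd.
unfold Rdiv; apply Rmult_le_compat.
- apply pow2_ge_0.
- left; apply Rinv_0_lt_compat; lra.
- apply pow_incr; lra.
- apply Rinv_le_contravar; lra.
Qed.

(** Braking forces [a < 0]; clearing the denominator leaves [v * v <= 2 * v * (- a * T)], which
    follows from [v < - a * T]. *)
Lemma stopping_distance_le (T v a : R) :
  0 <= v -> v + a * T < 0 -> 0 < T -> - (v ^ 2 / (2 * a)) <= v * T.
Proof.
intros Hv Hstop HT.
assert (Ha : a < 0) by nra.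
(* Moving the sign makes the denominator positive, so multiplying by it keeps the order. *)
replace (- (v ^ 2 / (2 * a))) with (v ^ 2 / (2 * - a)) by (field; lra).
apply Rmult_le_reg_r with (2 * - a); [lra |].
unfold Rdiv; rewrite Rmult_assoc, Rinv_l by lra.
nra.
Qed.

Theorem theorem6 (as_min an_min an_max T v an : R)
  (Han_min : 0 < an_min) (Han_max : 0 < an_max) (HT : 0 < T)
  (Has : an_min < as_min) (Hv : 0 <= v)
  (Han : - an_min <= an <= an_max) :
  msd1 as_min an_max T v >= msd3 as_min T v an /\
  msd5 an_min T v an >= msd3 as_min T v an.
Proof.
unfold msd1, msd3, msd5.
destruct (Rle_dec 0 (v + an * T)) as [Hgo | Hstop].
- assert (HaT : an * T <= an_max * T) by (apply Rmult_le_compat_r; lra).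
  assert (HaT2 : an * T ^ 2 <= an_max * T ^ 2)
    by (apply Rmult_le_compat_r; [apply pow2_ge_0 | lra]).
  split.
  + pose proof (sqr_div_le_compat (v + an * T) (v + an_max * T) as_min as_min
      ltac:(lra) ltac:(lra)); lra.
  + pose proof (sqr_div_le_compat (v + an * T) (v + an * T) an_min as_min
      ltac:(lra) ltac:(lra)); lra.
(* Here [msd5] and [msd3] are the same expression. *)
- split; [| lra].
  pose proof (stopping_distance_le T v an Hv ltac:(lra) HT).
  assert (0 <= an_max * T ^ 2)
    by (apply Rmult_le_pos; [lra | apply pow2_ge_0]).
  assert (0 <= (v + an_max * T) ^ 2 / (2 * as_min))
    by (apply Rle_mult_inv_pos; [apply pow2_ge_0 | lra]).
  lra.
Qed.
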